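(* The class $\mathcal{R}_3$ contains the Petersen graph, every prism $\mathrm{Pr}_n$ ($n\geq 3$), and every graph obtained from any of these by applying operations 1 and 2 an arbitrary number of times in any order, where operation 1 attaches to a vertex $v$ of the current graph a simple path of any length $\ell\geq 1$ whose other $\ell$ vertices are new, and operation 2 joins two vertices $x,y$ of the current graph by a simple path of length at least $3$ whose internal vertices are new.
   Context: All graphs are finite and simple. For a word $w$ and distinct letters $x,y$ occurring in $w$, $x$ and $y$ alternate in $w$ if deleting all letters other than copies of $x$ and $y$ from $w$ yields a word of the form $xyxy\cdots$ or $yxyx\cdots$ (of even or odd length). A graph $G=(V,E)$ is word-representable if there is a word $w$ over the alphabet $V$ (each vertex occurring in $w$) such that for all distinct $x,y\in V$, $x$ and $y$ alternate in $w$ if and only if $(x,y)\in E$. A word is $k$-uniform if each of its letters occurs exactly $k$ times; $G$ is $k$-word-representable if some $k$-uniform word represents it. The representation number $\mathcal{R}(G)$ of a word-representable graph is the least such $k$, and $\mathcal{R}_k$ denotes the class of word-representable graphs with representation number exactly $k$. For $n\geq 3$, the prism $\mathrm{Pr}_n$ consists of two cycles $1\,2\cdots n$ and $1'2'\cdots n'$ together with the edges $(i,i')$, $i=1,\ldots,n$. The length of a path is its number of edges. *)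

(* Defs.v *)
From mathcomp Require Import all_boot.
Set Implicit Arguments. Unset Strict Implicit. Unset Printing Implicit Defensive.

Record sgraph := SGraph {
  vert :> finType;
  adj : rel vert;
  adj_sym : symmetric adj;
  adj_irr : irreflexive adj }.

Definition simp (T : eqType) (e : rel T) : rel T :=
  fun x y => (x != y) && (e x y || e y x).

Lemma simp_sym (T : eqType) (e : rel T) : symmetric (simp e).
Proof. by move=> x y; rewrite /simp eq_sym orbC. Qed.

Lemma simp_irr (T : eqType) (e : rel T) : irreflexive (simp e).
Proof. by move=> x; rewrite /simp eqxx. Qed.

Definition mkgraph (T : finType) (e : rel T) : sgraph :=
  @SGraph T (simp e) (@simp_sym T e) (@simp_irr T e).

Definition alt_word (T : eqType) (a b : T) (n : nat) : seq T :=
  [seq (if odd i then b else a) | i <- iota 0 n].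

Definition alternate (T : eqType) (w : seq T) (x y : T) : Prop :=
  exists n, [seq z <- w | (z == x) || (z == y)] = alt_word x y n
         \/ [seq z <- w | (z == x) || (z == y)] = alt_word y x n.

Definition represents (G : sgraph) (w : seq G) : Prop :=
  (forall v : G, v \in w) /\
  (forall x y : G, x != y -> (alternate w x y <-> adj x y)).

Definition word_representable (G : sgraph) : Prop := exists w : seq G, represents w.

Definition uniform (T : eqType) (k : nat) (w : seq T) : Prop :=
  forall v : T, count_mem v w = k.

Definition k_word_representable (G : sgraph) (k : nat) : Prop :=
  exists w : seq G, uniform k w /\ represents w.

Definition rep_number_is (G : sgraph) (k : nat) : Prop :=
  k_word_representable G k /\ (forall j, j < k -> ~ k_word_representable G j).

Definition in_R (k : nat) (G : sgraph) : Prop :=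
  word_representable G /\ rep_number_is G k.

(* Petersen graph = Kneser graph K(5,2): 2-subsets of {0..4}, adjacent iff disjoint *)
Definition pet_vert := {A : {set 'I_5} | #|A| == 2}.
Definition petersen : sgraph :=
  @mkgraph (pet_vert) (fun A B => [disjoint val A & val B]).

(* Prism Pr_n: vertices (false,i) = i (outer cycle), (true,i) = i' (inner cycle) *)
Definition prism_rel (n : nat) : rel (bool * 'I_n)%type :=
  fun u w => if u.1 == w.1 then (val w.2 == (val u.2).+1 %% n)
             else (val u.2 == val w.2).
Definition prism (n : nat) : sgraph := @mkgraph (bool * 'I_n)%type (@prism_rel n).

(* Operation 1: attach at v a path v - p_0 - p_1 - ... - p_(l-1) of length l,
   new vertices p_i = inr i. *)
Definition op1_rel (G : sgraph) (v : G) (l : nat) : rel (G + 'I_l)%type :=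
  fun u w => match u, w with
  | inl a, inl b => adj a b
  | inl a, inr j => (a == v) && (val j == 0)
  | inr i, inr j => val j == (val i).+1
  | inr _, inl _ => false
  end.
Definition op1 (G : sgraph) (v : G) (l : nat) : sgraph :=
  @mkgraph (G + 'I_l)%type (@op1_rel G v l).

(* Operation 2: join x and y by a path x - p_0 - ... - p_(k-1) - y of length k+1,
   new internal vertices p_i = inr i. *)
Definition op2_rel (G : sgraph) (x y : G) (k : nat) : rel (G + 'I_k)%type :=
  fun u w => match u, w with
  | inl a, inl b => adj a b
  | inl a, inr j => ((a == x) && (val j == 0)) || ((a == y) && (val j == k.-1))
  | inr i, inr j => val j == (val i).+1
  | inr _, inl _ => false
  end.
Definition op2 (G : sgraph) (x y : G) (k : nat) : sgraph :=
  @mkgraph (G + 'I_k)%type (@op2_rel G x y k).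

Inductive generated : sgraph -> Prop :=
  | gen_petersen : generated petersen
  | gen_prism n : 3 <= n -> generated (prism n)
  | gen_op1 (G : sgraph) (v : G) (l : nat) :
      generated G -> 1 <= l -> generated (op1 v l)
  | gen_op2 (G : sgraph) (x y : G) (len : nat) :
      generated G -> x != y -> 3 <= len -> generated (op2 x y len.-1).

(* Main.v *)
Require Import Defs.
From mathcomp Require Import all_boot zify.
Set Implicit Arguments. Unset Strict Implicit. Unset Printing Implicit Defensive.

(** A word in which every letter occurs three times is recorded by the
    increasing positions [p v < q v < r v] of each letter. In this form the
    upper bound is a matter of inserting new triples: a leaf is placed tightly
    around an occurrence of its neighbour, a path with two inner vertices
    tightly around one occurrence of each of its ends, and the prism receives
    a cyclically periodic arrangement.

    For the lower bound, a 2-uniform word is a chord diagram. Three pairwise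
    disjoint chords crossing a common chord have a middle one, which separates
    the other two, so every path joining these must enter the closed
    neighbourhood of the middle one. The Petersen graph and the prisms with
    [n >= 4] have paths violating this; the triangular prism is treated
    directly. Chord diagrams restrict to induced subgraphs, hence the bound
    survives both operations. *)

(** * Position models of graphs and their restriction to induced subgraphs *)

Definition cross2 (a b x y : nat) : bool :=
  [&& a < x, x < b & b < y] || [&& x < a, a < y & y < b].

Definition alt3 (a b c x y z : nat) : bool :=
  [&& a < x, x < b, b < y, y < c & c < z] ||
  [&& x < a, a < y, y < b, b < z & z < c].

Definition model2 (G : sgraph) : Prop :=
  exists p q : G -> nat,
  [/\ forall v, p v < q v,
      forall u v, u != v ->
        [&& p u != p v, p u != q v, q u != p v & q u != q v]
    & forall u v, u != v -> adj u v = cross2 (p u) (q u) (p v) (q v)].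

Definition disjoint3 (a b c x y z : nat) : bool :=
  [&& a != x, a != y, a != z, b != x, b != y, b != z, c != x, c != y & c != z].

(** Positions are arbitrary naturals rather than indices into a word: gaps are allowed, so that
    rescaling makes room for new letters. *)
Definition model3 (G : sgraph) : Prop :=
  exists p q r : G -> nat,
  [/\ forall v, p v < q v < r v,
      forall u v, u != v -> disjoint3 (p u) (q u) (r u) (p v) (q v) (r v)
    & forall u v, u != v ->
        adj u v = alt3 (p u) (q u) (r u) (p v) (q v) (r v)].

Definition embeds (H G : sgraph) : Prop :=
  exists2 f : H -> G, injective f & forall x y, adj (f x) (f y) = adj x y.

Lemma model2_embeds (H G : sgraph) : embeds H G -> model2 G -> model2 H.
Proof.
move=> [f fI fA] [p [q [P1 P2 P3]]]; exists (p \o f), (q \o f); split => //= u v uv.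
  by apply: P2; rewrite (inj_eq fI).
by rewrite -fA P3 // (inj_eq fI).
Qed.

Lemma model3_embeds (H G : sgraph) : embeds H G -> model3 G -> model3 H.
Proof.
move=> [f fI fA] [p [q [r [P1 P2 P3]]]].
exists (p \o f), (q \o f), (r \o f); split => //= u v uv.
  by apply: P2; rewrite (inj_eq fI).
by rewrite -fA P3 // (inj_eq fI).
Qed.

(** * Translation between words and positions *)

Lemma increasing2_unique a b s t : a < b -> s < t ->
  (s == a) || (s == b) -> (t == a) || (t == b) -> s = a /\ t = b.
Proof.
by move=> ab st /orP[] /eqP ? /orP[] /eqP ?; subst s t; split=> //; lia.
Qed.

Lemma increasing3_unique a b c s t u : a < b < c -> s < t -> t < u ->
  [|| s == a, s == b | s == c] -> [|| t == a, t == b | t == c] ->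
  [|| u == a, u == b | u == c] -> [/\ s = a, t = b & u = c].
Proof.
by move=> abc st tu /or3P[] /eqP ? /or3P[] /eqP ? /or3P[] /eqP ?;
  subst s t u; split=> //; lia.
Qed.

Definition before {T : eqType} : rel (nat * T) := fun a b => a.1 < b.1.

Lemma before_trans (T : eqType) : transitive (@before T).
Proof. by move=> b a c; apply: ltn_trans. Qed.

(** Timed words are strictly sorted, so a restriction of such a word is known as soon as its set of
    entries is known. *)
Lemma before_sorted_eq (T : eqType) (s t : seq (nat * T)) :
  sorted before s -> sorted before t -> s =i t -> s = t.
Proof.
by apply: irr_sorted_eq; [exact: before_trans | move=> a; rewrite /before ltnn].
Qed.

Definition alternating (T : eqType) (s : seq T) (x y : T) : Prop :=
  exists n, s = alt_word x y n \/ s = alt_word y x n.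

(** [F] stands for a timed word restricted to [x] and [y]. Alternation prescribes its letters, and
    the increasing times then match the given ones in order. Conversely, crossing chords give an
    explicit sorted list with the members of [F], hence [F] itself. *)
Lemma alternating4 (T : eqType) (F : seq (nat * T)) (x y : T) a b c d : x != y ->
  a < b -> c < d -> [&& a != c, a != d, b != c & b != d] ->
  sorted before F -> F =i [:: (a, x); (b, x); (c, y); (d, y)] ->
  alternating (map snd F) x y <-> cross2 a b c d.
Proof.
move=> xy ab cd dd sF memF.
have uF : uniq F by apply: sorted_uniq sF; [exact: before_trans | move=> e; rewrite /before ltnn].
have szF : size F = 4.
  have : perm_eq F [:: (a, x); (b, x); (c, y); (d, y)].
    apply: uniq_perm => //; rewrite /= !inE !xpair_eqE (negbTE xy) eqxx !andbF !andbT !orbF /=.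
    lia.
  by move/perm_size.
split.
  case=> n; move: szF sF memF {uF}.
  case: F => [|[t1 z1] [|[t2 z2] [|[t3 z3] [|[t4 z4] []]]]] //= _ sF memF.
  rewrite /before /= in sF.
  have yx : y == x = false by rewrite eq_sym (negbTE xy).
  have E1 := memF (t1, z1); have E2 := memF (t2, z2).
  have E3 := memF (t3, z3); have E4 := memF (t4, z4).
  rewrite !inE !xpair_eqE !eqxx /= ?orbT in E1 E2 E3 E4.
  case=> E; (have n4 : n = 4 by have := congr1 size E; rewrite size_map size_iota);
  move: E; rewrite n4 /alt_word /= => -[? ? ? ?]; subst z1 z2 z3 z4;
  rewrite ?eqxx ?(negbTE xy) ?yx ?andbF ?andbT ?orbF /= in E1 E2 E3 E4;
  case/and4P: sF => s1 s2 s3 _; have s13 := ltn_trans s1 s2; have s24 := ltn_trans s2 s3.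
    have [? ?] := increasing2_unique ab s13 (esym E1) (esym E3).
    have [? ?] := increasing2_unique cd s24 (esym E2) (esym E4).
    by subst; rewrite /cross2 s1 s2 s3.
  have [? ?] := increasing2_unique ab s24 (esym E2) (esym E4).
  have [? ?] := increasing2_unique cd s13 (esym E1) (esym E3).
  by subst; rewrite /cross2 s1 s2 s3 orbT.
rewrite /cross2 => /orP[] /and3P[h1 h2 h3].
  have -> : F = [:: (a, x); (c, y); (b, x); (d, y)].
    apply: before_sorted_eq => //; first by rewrite /= /before /= h1 h2 h3.
    by move=> e; rewrite memF !inE; case: (e == _); case: (e == _); case: (e == _).
  by exists 4; left.
have -> : F = [:: (c, y); (a, x); (d, y); (b, x)].
  apply: before_sorted_eq => //; first by rewrite /= /before /= h1 h2 h3.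
  move=> e; rewrite memF !inE.
  by case: (e == (a, x)); case: (e == (b, x)); case: (e == (c, y)); case: (e == (d, y)).
by exists 4; right.
Qed.

Lemma alternating6 (T : eqType) (F : seq (nat * T)) (x y : T) a b c d e f : x != y ->
  a < b < c -> d < e < f -> disjoint3 a b c d e f ->
  sorted before F -> F =i [:: (a, x); (b, x); (c, x); (d, y); (e, y); (f, y)] ->
  alternating (map snd F) x y <-> alt3 a b c d e f.
Proof.
move=> xy ab cd dd sF memF.
have uF : uniq F by apply: sorted_uniq sF; [exact: before_trans | move=> g; rewrite /before ltnn].
have szF : size F = 6.
  have : perm_eq F [:: (a, x); (b, x); (c, x); (d, y); (e, y); (f, y)].
    apply: uniq_perm => //; rewrite /= !inE !xpair_eqE (negbTE xy) eqxx !andbF !andbT !orbF /=.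
    lia.
  by move/perm_size.
rewrite /disjoint3 in dd.
split.
  case=> n; move: szF sF memF {uF}.
  case: F => [|[t1 z1] [|[t2 z2] [|[t3 z3] [|[t4 z4] [|[t5 z5] [|[t6 z6] []]]]]]] //= _ sF memF.
  rewrite /before /= in sF.
  have yx : y == x = false by rewrite eq_sym (negbTE xy).
  have E1 := memF (t1, z1); have E2 := memF (t2, z2).
  have E3 := memF (t3, z3); have E4 := memF (t4, z4).
  have E5 := memF (t5, z5); have E6 := memF (t6, z6).
  rewrite !inE !xpair_eqE !eqxx /= ?orbT in E1 E2 E3 E4 E5 E6.
  case=> E; (have n6 : n = 6 by have := congr1 size E; rewrite size_map size_iota);
  move: E; rewrite n6 /alt_word /= => -[? ? ? ? ? ?]; subst z1 z2 z3 z4 z5 z6;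
  rewrite ?eqxx ?(negbTE xy) ?yx ?andbF ?andbT ?orbF /= in E1 E2 E3 E4 E5 E6;
  case/and5P: sF => s1 s2 s3 s4 /andP[s5 _];
  have s13 := ltn_trans s1 s2; have s24 := ltn_trans s2 s3;
  have s35 := ltn_trans s3 s4; have s46 := ltn_trans s4 s5.
    have [? ? ?] := increasing3_unique ab s13 s35 (esym E1) (esym E3) (esym E5).
    have [? ? ?] := increasing3_unique cd s24 s46 (esym E2) (esym E4) (esym E6).
    by subst; rewrite /alt3 s1 s2 s3 s4 s5.
  have [? ? ?] := increasing3_unique ab s24 s46 (esym E2) (esym E4) (esym E6).
  have [? ? ?] := increasing3_unique cd s13 s35 (esym E1) (esym E3) (esym E5).
  by subst; rewrite /alt3 s1 s2 s3 s4 s5 orbT.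
rewrite /alt3 => /orP[] /and5P[h1 h2 h3 h4 h5].
  have -> : F = [:: (a, x); (d, y); (b, x); (e, y); (c, x); (f, y)].
    apply: before_sorted_eq => //; first by rewrite /= /before /= h1 h2 h3 h4 h5.
    move=> g; rewrite memF !inE.
    by case: (g == (a, x)); case: (g == (b, x)); case: (g == (c, x));
       case: (g == (d, y)); case: (g == (e, y)).
  by exists 6; left.
have -> : F = [:: (d, y); (a, x); (e, y); (b, x); (f, y); (c, x)].
  apply: before_sorted_eq => //; first by rewrite /= /before /= h1 h2 h3 h4 h5.
  move=> g; rewrite memF !inE.
  by case: (g == (a, x)); case: (g == (b, x)); case: (g == (c, x));
     case: (g == (d, y)); case: (g == (e, y)); case: (g == (f, y)).
by exists 6; right.
Qed.


Lemma alternate_timed (T : eqType) (s : seq (nat * T)) (x y : T) :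
  alternate (map snd s) x y <->
  alternating (map snd [seq e <- s | (e.2 == x) || (e.2 == y)]) x y.
Proof. by rewrite /alternate filter_map. Qed.

(** The word lists, for each time up to the largest [r v], the vertex occupying that time; vacant
    times are skipped. *)
Lemma model3_word (G : sgraph) : model3 G -> k_word_representable G 3.
Proof.
move=> [p [q [r [P1 P2 P3]]]].
pose at_ v t := [|| t == p v, t == q v | t == r v].
pose owner t := [pick v | at_ v t].
have ownerE t v : (owner t == Some v) = at_ v t.
  rewrite /owner; case: pickP => [u ut|nt]; last by rewrite nt.
  apply/eqP/idP => [[<-] //|vt]; congr Some; apply/eqP/negPn/negP => uv.
  have := P2 _ _ uv; rewrite /disjoint3; move: ut vt; rewrite /at_; lia.
pose f t := omap (pair t) (owner t).
pose s := pmap f (iota 0 (\max_v r v).+1).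
have mems t v : ((t, v) \in s) = at_ v t.
  rewrite mem_pmap; apply/mapP/idP => [[t' _]|vt].
    rewrite /f; case E: (owner t') => [u|] //= [-> ->].
    by rewrite -ownerE E.
  exists t; last by rewrite /f (eqP (_ : owner t == Some v)) // ownerE.
  rewrite mem_iota /=; have := leq_bigmax (F := r) v.
  have := P1 v; move: vt; rewrite /at_; lia.
have sS : sorted (@before G) s.
  have -> : @before G = relpre fst ltn by [].
  rewrite -sorted_map /s.
  have -> : forall l, map fst (pmap f l) = filter (fun t => owner t) l.
    elim=> [|t l IH] //=; rewrite [f t](_ : _ = omap (pair t) (owner t)) //.
    by case: (owner t) => [v|] /=; rewrite IH.
  by apply: sorted_filter; [exact: ltn_trans | exact: iota_ltn_sorted].
have sF P : sorted (@before G) (filter P s).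
  by apply: sorted_filter => //; exact: before_trans.
have U : uniform 3 (map snd s).
  move=> v; rewrite count_map -size_filter.
  suff -> : [seq e <- s | e.2 == v] = [:: (p v, v); (q v, v); (r v, v)] by [].
  apply: before_sorted_eq => //; first by rewrite /= /before /= andbT P1.
  move=> [t u]; rewrite mem_filter mems /= !inE !xpair_eqE /at_.
  by case: eqP => [->|]; rewrite ?andbT ?andbF.
exists (map snd s); split=> //; split=> [v|x y xy].
  by rewrite -has_pred1 has_count U.
rewrite alternate_timed P3 //.
apply: alternating6 => //; first exact: P2.
move=> [t u]; rewrite mem_filter mems /= !inE !xpair_eqE /at_.
case: (u =P x) => [->|ux]; first by rewrite (negbTE xy) !andbT !andbF !orbF.
by case: (u =P y) => [->|uy]; rewrite ?andbT ?andbF.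
Qed.

Lemma word_model2 (G : sgraph) : k_word_representable G 2 -> model2 G.
Proof.
move=> [w [U [_ A]]].
pose s := zip (iota 0 (size w)) w.
have szw : size (iota 0 (size w)) = size w by rewrite size_iota.
have ws : map snd s = w by apply: unzip2_zip; rewrite szw.
have sS : sorted (@before G) s.
  have -> : @before G = relpre fst ltn by [].
  rewrite -sorted_map (_ : map fst s = iota 0 (size w)) ?iota_ltn_sorted //.
  by apply: unzip1_zip; rewrite szw.
have sF P : sorted (@before G) (filter P s).
  by apply: sorted_filter => //; exact: before_trans.
have uS : uniq (map fst s) by rewrite (_ : map fst s = iota 0 (size w)) ?iota_uniq //;
  apply: unzip1_zip; rewrite szw.
(* The default is never reached: by uniformity the filtered list has exactly two entries. *)
pose p v := nth 0 (map fst [seq e <- s | e.2 == v]) 0.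
pose q v := nth 0 (map fst [seq e <- s | e.2 == v]) 1.
have Fv v : [seq e <- s | e.2 == v] = [:: (p v, v); (q v, v)] /\ p v < q v.
  have := sF (fun e => e.2 == v); rewrite /p /q.
  have : size [seq e <- s | e.2 == v] = 2.
    by rewrite size_filter -(U v) -[in RHS]ws count_map.
  have : all (fun e => e.2 == v) [seq e <- s | e.2 == v] by apply: filter_all.
  case: [seq e <- s | e.2 == v] => [|[t1 z1] [|[t2 z2] []]] //=.
  by rewrite /before /= !andbT => /andP[/eqP-> /eqP->].
have mems t v : ((t, v) \in s) = (t == p v) || (t == q v).
  have : ((t, v) \in [seq e <- s | e.2 == v]) = ((t, v) \in s).
    by rewrite mem_filter /= eqxx.
  by move=> <-; rewrite (Fv v).1 !inE !xpair_eqE eqxx !andbT.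
have pq v : p v < q v by case: (Fv v).
have func t u v : (t, u) \in s -> (t, v) \in s -> u = v.
  move=> h1 h2; pose i := index (t, u) s; pose j := index (t, v) s.
  have Ei : nth 0 (map fst s) i = t by rewrite (nth_map (t, u)) ?index_mem // nth_index.
  have Ej : nth 0 (map fst s) j = t by rewrite (nth_map (t, v)) ?index_mem // nth_index.
  have ij : i = j.
    by apply/eqP; rewrite -(nth_uniq 0 _ _ uS) ?size_map ?index_mem // Ei Ej.
  have : nth (t, u) s i = nth (t, u) s j by rewrite ij.
  by rewrite nth_index // /j nth_index // => -[].
have dd u v : u != v -> [&& p u != p v, p u != q v, q u != p v & q u != q v].
  move=> uv; apply/and4P; split; apply: contraNN uv => /eqP E; apply/eqP.
  - by apply: (func (p u)); rewrite mems ?eqxx // E eqxx.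
  - by apply: (func (p u)); rewrite mems ?eqxx // E eqxx orbT.
  - by apply: (func (q u)); rewrite mems ?eqxx ?orbT // E eqxx.
  - by apply: (func (q u)); rewrite mems ?eqxx ?orbT // E eqxx orbT.
exists p, q; split=> // x y xy.
apply/idP/idP.
  move/(A _ _ xy); rewrite -[w]ws alternate_timed.
  apply: (proj1 (alternating4 xy (pq x) (pq y) (dd _ _ xy) (sF _) _)).
  move=> [t u]; rewrite mem_filter mems /= !inE !xpair_eqE.
  case: (u =P x) => [->|ux]; first by rewrite (negbTE xy) !andbT !andbF !orbF.
  by case: (u =P y) => [->|uy]; rewrite ?andbT ?andbF.
move=> cr; apply/(A _ _ xy); rewrite -[w]ws alternate_timed; move: cr.
apply: (proj2 (alternating4 xy (pq x) (pq y) (dd _ _ xy) (sF _) _)).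
move=> [t u]; rewrite mem_filter mems /= !inE !xpair_eqE.
case: (u =P x) => [->|ux]; first by rewrite (negbTE xy) !andbT !andbF !orbF.
by case: (u =P y) => [->|uy]; rewrite ?andbT ?andbF.
Qed.


(** * Attaching a path at one vertex *)

Lemma alt3_sym a b c x y z : alt3 a b c x y z = alt3 x y z a b c.
Proof. by rewrite /alt3 orbC. Qed.

Lemma alt3_affine k d a b c x y z : 0 < k ->
  alt3 (k * a + d) (k * b + d) (k * c + d) (k * x + d) (k * y + d) (k * z + d)
    = alt3 a b c x y z.
Proof. by move=> k0; rewrite /alt3 !ltn_add2r !ltn_mul2l k0. Qed.

(** Used to refute alternation: a new letter placed tightly around an occurrence of its neighbour
    leaves no room there for any other old letter. *)
Lemma alt3_between12 a b c x y z : alt3 a b c x y z -> (a < x < b) || (a < y < b).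
Proof.
by rewrite /alt3 => /orP[] /and5P[h1 h2 h3 h4 h5]; apply/orP; [left|right]; apply/andP.
Qed.

Lemma alt3_between23 a b c x y z : alt3 a b c x y z -> (b < y < c) || (b < z < c).
Proof.
by rewrite /alt3 => /orP[] /and5P[h1 h2 h3 h4 h5]; apply/orP; [left|right]; apply/andP.
Qed.

Lemma adj_simp_inl (G : sgraph) (k : nat) (e : rel (G + 'I_k)) :
  (forall a b, e (inl a) (inl b) = adj a b) ->
  forall a b : G, simp e (inl a) (inl b) = adj a b.
Proof.
move=> H a b; rewrite /simp !H (adj_sym b a) orbb.
by case: eqP => //= -[->]; rewrite adj_irr.
Qed.

(** After scaling by four, the first two positions of the leaf enclose only the first occurrence of
    [v], which excludes all other neighbours. The third comes just after the second occurrence of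
    [v], which completes the alternation with [v]. *)
Lemma model3_leaf (G : sgraph) (v : G) : model3 G -> model3 (op1 v 1).
Proof.
move=> [p [q [r [P1 P2 P3]]]].
pose P (u : op1 v 1) := if u is inl a then 4 * p a + 2 else 4 * p v + 1.
pose Q (u : op1 v 1) := if u is inl a then 4 * q a + 2 else 4 * p v + 3.
pose R (u : op1 v 1) := if u is inl a then 4 * r a + 2 else 4 * q v + 3.
have adj_leaf (a : G) (i : 'I_1) :
    alt3 (P (inr i)) (Q (inr i)) (R (inr i)) (P (inl a)) (Q (inl a)) (R (inl a)) = (a == v).
  have [->|av] := eqVneq a v.
    by have /andP[? ?] := P1 v; rewrite /alt3 /=; apply/orP; left; apply/and5P; split; lia.
  apply/negP => /alt3_between12 /=; have := P2 _ _ av; rewrite /disjoint3; lia.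
have leafE (a : G) (i : 'I_1) : @adj (op1 v 1) (inl a) (inr i) = (a == v).
  by rewrite /= /simp /= orbF ord1 eqxx andbT.
exists P, Q, R; split.
- by case=> [a|i] /=; [have := P1 a | have := P1 v]; lia.
- case=> [a|i] [b|j] ab; rewrite /disjoint3 /=; try lia.
  + by have := P2 _ _ ab; rewrite /disjoint3; lia.
  + by rewrite !ord1 eqxx in ab.
- case=> [a|i] [b|j] ab.
  + rewrite /P /Q /R alt3_affine // -P3; last by apply: contraNneq ab => ->.
    by rewrite /= adj_simp_inl.
  + by rewrite leafE alt3_sym adj_leaf.
  + by rewrite adj_sym leafE adj_leaf.
  + by rewrite !ord1 eqxx in ab.
Qed.

(** A longer path is a shorter one with a leaf at its last vertex [ord_max], so leaves suffice. *)
Lemma embeds_path (G : sgraph) (v : G) (l : nat) :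
  embeds (op1 v l.+2) (@op1 (op1 v l.+1) (inr ord_max) 1).
Proof.
pose f (u : op1 v l.+2) : @op1 (op1 v l.+1) (inr ord_max) 1 :=
  match u with
  | inl a => inl (inl a)
  | inr i => if insub (val i) is Some j then inl (inr j) else inr ord0
  end.
exists f.
  move=> [a|i] [b|j] //=.
  - by move=> [->].
  - by case: insubP.
  - by case: insubP.
  - case: insubP => [i' _ vi|/= ni]; case: insubP => [j' _ vj|/= nj] //.
      by move=> [E]; congr inr; apply: val_inj; rewrite /= -vi -vj E.
    by move=> _; congr inr; apply: val_inj => /=; have := ltn_ord i; have := ltn_ord j; lia.
move=> [a|i] [b|j] /=.
- by rewrite [LHS]adj_simp_inl => [|c d]; rewrite [in LHS]/= ?adj_simp_inl.
- case: insubP => [j' _ vj|/= nj]; rewrite /simp /= ?orbF.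
    by rewrite /simp /= -vj !orbF orbb.
  by have := ltn_ord j; case: (a == v) => //=; lia.
- case: insubP => [i' _ vi|/= ni]; rewrite /simp /= ?orbF.
    by rewrite /simp /= -vi !orbF orbb.
  by have := ltn_ord i; case: (b == v) => //=; lia.
- have := ltn_ord i; have := ltn_ord j.
  case: insubP => [i' _ vi|/= ni]; case: insubP => [j' _ vj|/= nj];
    rewrite /simp /= ?(inj_eq inl_inj) ?(inj_eq inr_inj) -?val_eqE /=;
    rewrite ?/simp /= ?(inj_eq inr_inj) -?val_eqE /= ?vi ?vj; lia.
Qed.

Lemma model3_op1 (G : sgraph) (v : G) (l : nat) :
  0 < l -> model3 G -> model3 (op1 v l).
Proof.
case: l => // l _ mG; elim: l => [|l IH]; first exact: model3_leaf.
exact/(model3_embeds (embeds_path v l))/model3_leaf.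
Qed.

(** * Joining two vertices by a path *)

(* Here [a < b < c] and [x < y < z] are the positions of the two ends of the
   new path; the first new vertex surrounds position [i] tightly, the second
   one position [j]. *)
Definition path_slot (a b c x y z i j : nat) : bool :=
  [&& i < j, ((i == a) && (b < j < c)) || ((i == b) && (c < j))
    & ((j == y) && (i < x)) || ((j == z) && (x < i < y))].

(** Some interleavings, such as [a < x < y < b < c < z], offer no slot in the given direction; then
    the path is laid out from the other end. *)
Lemma path_slot_exists a b c x y z :
  a < b < c -> x < y < z -> disjoint3 a b c x y z ->
  exists i j, path_slot a b c x y z i j || path_slot x y z a b c i j.
Proof.
move=> abc xyz /and5P[ax ay _ bx /and5P[bY bz _ cy cz]].
have slot i j : path_slot a b c x y z i j ->
    exists i j, path_slot a b c x y z i j || path_slot x y z a b c i j.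
  by exists i, j; apply/orP; left.
have slot' i j : path_slot x y z a b c i j ->
    exists i j, path_slot a b c x y z i j || path_slot x y z a b c i j.
  by exists i, j; apply/orP; right.
case: (ltngtP a x) ax => // ltax _; case: (ltngtP b y) bY => // ltby _.
- case: (ltngtP c y) cy => // ltcy _.
    case: (ltngtP b x) bx => // ltbx _.
      by apply: (slot b y); rewrite /path_slot !eqxx; lia.
    by apply: (slot b z); rewrite /path_slot !eqxx; lia.
  by apply: (slot a y); rewrite /path_slot !eqxx; lia.
- case: (ltngtP c z) cz => // ltcz _.
    by apply: (slot' x c); rewrite /path_slot !eqxx; lia.
  by apply: (slot' y c); rewrite /path_slot !eqxx; lia.
- case: (ltngtP c z) cz => // ltcz _.
    by apply: (slot b z); rewrite /path_slot !eqxx; lia.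
  by apply: (slot a z); rewrite /path_slot !eqxx; lia.
- case: (ltngtP b z) bz => // ltbz _.
    by apply: (slot' x b); rewrite /path_slot !eqxx; lia.
  case: (ltngtP a y) ay => // ltay _.
    by apply: (slot' y c); rewrite /path_slot !eqxx; lia.
  by apply: (slot' y b); rewrite /path_slot !eqxx; lia.
Qed.

Lemma embeds_op2_swap (G : sgraph) (x y : G) : embeds (op2 x y 2) (op2 y x 2).
Proof.
pose f (u : op2 x y 2) : op2 y x 2 := if u is inr i then inr (rev_ord i) else u.
exists f.
  by move=> [a|i] [b|j] //= E; rewrite (rev_ord_inj (inr_inj E)).
move=> [a|[[|[|i]] //= ?]] [b|[[|[|j]] //= ?]]; rewrite /simp /= -?val_eqE //=;
  by rewrite ?andbT ?andbF ?orbF.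
Qed.

(** Old positions become 4 modulo 8. The first new vertex encloses slot [i] and recurs just after
    slot [j]; the second starts just before slot [i] and encloses slot [j]. The offsets interleave
    the two, so they are adjacent. *)
Lemma model3_op2_slot (G : sgraph) (x y : G) (p q r : G -> nat) (i j : nat) :
  x != y ->
  (forall v, p v < q v < r v) ->
  (forall u v, u != v -> disjoint3 (p u) (q u) (r u) (p v) (q v) (r v)) ->
  (forall u v, u != v -> adj u v = alt3 (p u) (q u) (r u) (p v) (q v) (r v)) ->
  path_slot (p x) (q x) (r x) (p y) (q y) (r y) i j ->
  model3 (op2 x y 2).
Proof.
move=> xy P1 P2 P3 /and3P[ij si sj].
pose sel (n : 'I_2) (s t : nat) := if val n == 0 then s else t.
pose P (u : op2 x y 2) :=
  match u with inl a => 8 * p a + 4 | inr n => sel n (8 * i + 2) (8 * i + 3) end.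
pose Q (u : op2 x y 2) :=
  match u with inl a => 8 * q a + 4 | inr n => sel n (8 * i + 5) (8 * j + 3) end.
pose R (u : op2 x y 2) :=
  match u with inl a => 8 * r a + 4 | inr n => sel n (8 * j + 5) (8 * j + 6) end.
have px := P1 x; have py := P1 y.
(* The only old position between the first two is [8 * i + 4], an occurrence of [x]. For the second
   new vertex, the last two positions play this part, with [y]. *)
have alt_u (a : G) : alt3 (8 * i + 2) (8 * i + 5) (8 * j + 5)
    (8 * p a + 4) (8 * q a + 4) (8 * r a + 4) = (a == x).
  have [->|ax] := eqVneq a x.
    case/orP: si => /andP[/eqP E h]; rewrite /alt3; apply/orP; [left|right];
      by apply/and5P; split; lia.
  apply/negP => /alt3_between12; have := P2 _ _ ax; rewrite /disjoint3; clear -si px; lia.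
have alt_v (a : G) : alt3 (8 * i + 3) (8 * j + 3) (8 * j + 6)
    (8 * p a + 4) (8 * q a + 4) (8 * r a + 4) = (a == y).
  have [->|ay] := eqVneq a y.
    case/orP: sj => /andP[/eqP E h]; rewrite /alt3; apply/orP; [left|right];
      by apply/and5P; split; lia.
  apply/negP => /alt3_between23; have := P2 _ _ ay; rewrite /disjoint3; clear -sj py; lia.
have alt_uv : alt3 (8 * i + 2) (8 * i + 5) (8 * j + 5)
    (8 * i + 3) (8 * j + 3) (8 * j + 6).
  by rewrite /alt3; apply/orP; left; apply/and5P; split; lia.
have newE (a : G) (n : 'I_2) :
    @adj (op2 x y 2) (inl a) (inr n) = alt3 (P (inl a)) (Q (inl a)) (R (inl a))
                                            (P (inr n)) (Q (inr n)) (R (inr n)).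
  rewrite alt3_sym /= /simp /= orbF.
  by case: n => -[|[|n]] //= lt_n; rewrite /sel /= ?alt_u ?alt_v ?andbT ?andbF ?orbF.
exists P, Q, R; split.
- by case=> [a|[[|[|n]] //= lt_n]] /=; [have := P1 a|rewrite /sel /=|rewrite /sel /=]; lia.
- case=> [a|[[|[|m]] //= lt_m]] [b|[[|[|n]] //= lt_n]] ab; rewrite /disjoint3 /sel /=; try lia.
  + by move: (P2 _ _ ab); rewrite /disjoint3; clear; lia.
- case=> [a|m] [b|n] ab.
  + rewrite /P /Q /R alt3_affine // -P3; last by apply: contraNneq ab => ->.
    by rewrite /= adj_simp_inl.
  + exact: newE.
  + by rewrite adj_sym newE alt3_sym.
  + move: m n ab => [[|[|m]] //= lt_m] [[|[|n]] //= lt_n] // _;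
      by rewrite /sel /simp /= ?alt_uv // alt3_sym alt_uv.
Qed.

Lemma model3_op2_short (G : sgraph) (x y : G) :
  x != y -> model3 G -> model3 (op2 x y 2).
Proof.
move=> xy [p [q [r [P1 P2 P3]]]].
have [i [j /orP[]]] := path_slot_exists (P1 x) (P1 y) (P2 _ _ xy).
  exact: model3_op2_slot xy P1 P2 P3.
move=> s; apply: model3_embeds (embeds_op2_swap x y) _.
by apply: model3_op2_slot s => //; rewrite eq_sym.
Qed.

(** A path with [l.+4] edges splits into a pendant path with [l.+1] edges at [x] and a path with
    three edges from its end to [y]. *)
Lemma embeds_op2 (G : sgraph) (x y : G) (l : nat) :
  embeds (op2 x y l.+3) (@op2 (op1 x l.+1) (inr ord_max) (inl y) 2).
Proof.
pose f (u : op2 x y l.+3) : @op2 (op1 x l.+1) (inr ord_max) (inl y) 2 :=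
  match u with
  | inl a => inl (inl a)
  | inr i => if insub (val i) is Some j then inl (inr j) else inr (inord (i - l.+1))
  end.
have vi (i : 'I_l.+3) : ~~ (i < l.+1) -> (inord (i - l.+1) : 'I_2) = i - l.+1 :> nat.
  by move=> ni; rewrite inordK //; have := ltn_ord i; lia.
exists f.
  move=> [a|i] [b|j] //=.
  - by move=> [->].
  - by case: insubP.
  - by case: insubP.
  - case: insubP => [i' _ Ei|/= ni]; case: insubP => [j' _ Ej|/= nj] //.
      by move=> [E]; congr inr; apply: val_inj; rewrite /= -Ei -Ej E.
    move=> [/(congr1 val)] /=; rewrite !vi // => E.
    by congr inr; apply: val_inj => /=; lia.
move=> [a|i] [b|j] /=.
- by rewrite [LHS]adj_simp_inl => [|c d]; rewrite [in LHS]/= ?adj_simp_inl.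
- have := ltn_ord j; case: insubP => [j' /= lj Ej|/= nj] lt_j; rewrite /simp /= ?orbF.
    by rewrite /simp /= -Ej !orbF orbb (_ : (_ == l.+2) = false) ?andbF ?orbF //; lia.
  rewrite vi // (inj_eq inl_inj); case: (a == x) => //=; case: (a == y) => //=; lia.
- have := ltn_ord i; case: insubP => [i' /= li Ei|/= ni] lt_i; rewrite /simp /= ?orbF.
    by rewrite /simp /= -Ei !orbF orbb (_ : (_ == l.+2) = false) ?andbF ?orbF //; lia.
  rewrite vi // (inj_eq inl_inj); case: (b == x) => //=; case: (b == y) => //=; lia.
- have := ltn_ord i; have := ltn_ord j.
  case: insubP => [i' /= li Ei|/= ni]; case: insubP => [j' /= lj Ej|/= nj];
    rewrite /simp /= ?(inj_eq inl_inj) ?(inj_eq inr_inj) -?val_eqE /=;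
    rewrite ?/simp /= ?(inj_eq inr_inj) -?val_eqE /= ?Ei ?Ej ?vi //; lia.
Qed.

Lemma model3_op2 (G : sgraph) (x y : G) (l : nat) :
  1 < l -> x != y -> model3 G -> model3 (op2 x y l).
Proof.
case: l => [|[|[|l]]] // _ xy mG; first exact: model3_op2_short.
apply: model3_embeds (embeds_op2 x y l) _.
by apply: model3_op2_short => //; apply: model3_op1.
Qed.

Lemma op1_embeds (G : sgraph) (v : G) (l : nat) : embeds G (op1 v l).
Proof. by exists inl => [|a b]; [exact: inl_inj | rewrite /= adj_simp_inl]. Qed.

Lemma op2_embeds (G : sgraph) (x y : G) (l : nat) : embeds G (op2 x y l).
Proof. by exists inl => [|a b]; [exact: inl_inj | rewrite /= adj_simp_inl]. Qed.


(** * Separation by a chord *)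

(** Separation by the closed neighbourhood of [b], witnessed by a two-colouring so that the sides of
    a chord can serve directly. *)
Definition separates (G : sgraph) (b a c : G) : Prop :=
  exists2 S : G -> bool, S a != S c &
    forall z t, z != b -> t != b -> ~~ adj z b -> ~~ adj t b -> adj z t -> S z = S t.

Lemma noncrossing_same_side a b x y : x < y -> x != a -> x != b -> y != a -> y != b ->
  ~~ cross2 x y a b -> a < b -> (a < x < b) = (a < y < b).
Proof. rewrite /cross2; lia. Qed.

(* The chords of [a], [b], [c] all cross the chord of [x]; the one meeting it
   between the other two keeps these on different sides. *)
Lemma chord_separates (G : sgraph) (x a b c : G) : model2 G ->
  uniq [:: x; a; b; c] -> adj x a -> adj x b -> adj x c ->
  ~~ adj a b -> ~~ adj b c -> ~~ adj c a ->
  [\/ separates b a c, separates c b a | separates a c b].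
Proof.
move=> [p [q [P1 P2 P3]]].
(* For a chord crossing that of [x], this is its unique end under the chord of [x]; the order of
   these ends decides which chord is in the middle. *)
pose inside v := if p x < p v < q x then p v else q v.
pose mid a b c := inside a < inside b < inside c.
have key u v w : x != u -> x != v -> x != w -> u != v -> w != v ->
    adj x u -> adj x v -> adj x w -> ~~ adj u v -> ~~ adj w v ->
    mid u v w || mid w v u -> separates v u w.
  move=> xu xv xw uv wv; rewrite !P3 // => Axu Axv Axw Nuv Nwv M.
  (* A chord not crossing that of [v] has both ends on one side of it, and two such chords that
     cross each other lie on the same side. *)
  exists (fun z => p v < p z < q v).
    have side t : t != v -> ~~ cross2 (p t) (q t) (p v) (q v) ->
        (p v < p t < q v) = (p v < inside t < q v).
      move=> /P2/and4P[n1 n2 n3 n4] N; rewrite /inside; case: ifP => // _.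
      exact: noncrossing_same_side.
    (* The other end of [v] lies outside the chord of [x], so the chord of [v] cuts the interval of
       [x] at [inside v], with [inside u] and [inside w] on different sides. *)
    have ends t : cross2 (p x) (q x) (p t) (q t) ->
        (p x < inside t < q x) &&
        ((p t == inside t) && (q x < q t) || (q t == inside t) && (p t < p x)).
      by rewrite /inside /cross2; clear; case: ifP; lia.
    rewrite !side //; have := ends _ Axv; have /andP[iu _] := ends _ Axu.
    by have /andP[iw _] := ends _ Axw; move: M iu iw; rewrite /mid; clear; lia.
  move=> z t zv tv; have [->//|zt] := eqVneq z t; rewrite !P3 // => Nz Nt C.
  move: (P1 z) (P1 t) (P1 v) (P2 _ _ zv) (P2 _ _ tv) Nz Nt C.
  rewrite /cross2; clear; lia.
move=> /= /and4P[]; rewrite !inE !negb_or => /and3P[xa xb xc] /andP[ab ac] bc _.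
move=> Axa Axb Axc Nab Nbc Nca.
have neq u v : u != v -> inside u != inside v.
  by rewrite /inside => /P2/and4P[? ? ? ?]; case: ifP; case: ifP.
have n1 := neq _ _ ab; have n2 := neq _ _ ac; have n3 := neq _ _ bc.
have : [|| mid a b c || mid c b a, mid b c a || mid a c b | mid c a b || mid b a c].
  by rewrite /mid; clear -n1 n2 n3; lia.
have [ba ca cb] : [/\ b != a, c != a & c != b] by rewrite ![_ == a]eq_sym [c == b]eq_sym.
have [Nba Ncb Nac] : [/\ ~~ adj b a, ~~ adj c b & ~~ adj a c].
  by rewrite (adj_sym b) (adj_sym c b) (adj_sym a c).
by case/or3P=> M; [apply: Or31|apply: Or32|apply: Or33]; apply: key.
Qed.


(** Along a path avoiding the closed neighbourhood of [b] the colouring is constant, yet it differs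
    at the ends. *)
Lemma separates_path (G : sgraph) (b a c : G) (s : seq G) : separates b a c ->
  path (@adj G) a s -> last a s = c ->
  ~~ all (fun z => (z != b) && ~~ adj z b) (a :: s).
Proof.
move=> [S Sac SP] + E; rewrite -E in Sac; apply: contraTN => /=.
elim: s a Sac {E} => [|z s IH] a /=; first by rewrite eqxx.
move=> Sa /andP[/andP[ab Aab] /andP[/andP[zb Azb] alls]].
apply/negP => /andP[az pz].
have Saz := SP _ _ ab zb Aab Azb az.
by have := IH z; rewrite -Saz zb Azb alls pz => /(_ Sa isT).
Qed.

(** * The Petersen graph *)

(** Numbering the ten 2-subsets turns adjacency into a computation on indices. *)
Definition pair_list : seq (nat * nat) :=
  [:: (0,1); (0,2); (0,3); (0,4); (1,2); (1,3); (1,4); (2,3); (2,4); (3,4)].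

Definition pairs_disjoint (i j : nat) : bool :=
  let: (a, b) := nth (0,0) pair_list i in
  let: (c, d) := nth (0,0) pair_list j in
  [&& a != c, a != d, b != c & b != d].

Definition petersen10 : sgraph :=
  @mkgraph 'I_10 (fun i j => pairs_disjoint i j).

Definition pair_set (i : nat) : {set 'I_5} :=
  let: (a, b) := nth (0,0) pair_list i in [set inord a; inord b].

Lemma pair_list_bound i : i < 10 ->
  (nth (0,0) pair_list i).1 < (nth (0,0) pair_list i).2 < 5.
Proof.
have H : all (fun i => (nth (0,0) pair_list i).1 < (nth (0,0) pair_list i).2 < 5)
  (iota 0 10) by [].
by move=> lt_i; apply: (allP H); rewrite mem_iota.
Qed.

Lemma card_pair_set (i : 'I_10) : #|pair_set i| == 2.
Proof.
have := pair_list_bound (ltn_ord i); rewrite /pair_set.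
case: (nth _ _ _) => a b /= /andP[ab b5].
by rewrite cards2 -val_eqE /= !inordK ?(ltn_trans ab) // neq_ltn ab.
Qed.

Lemma pair_set_disjoint (i j : 'I_10) :
  [disjoint pair_set i & pair_set j] = pairs_disjoint i j.
Proof.
have := pair_list_bound (ltn_ord i); have := pair_list_bound (ltn_ord j).
rewrite /pair_set /pairs_disjoint.
case: (nth _ _ i) => a b; case: (nth _ _ j) => c d /= /andP[cd d5] /andP[ab b5].
have a5 := ltn_trans ab b5; have c5 := ltn_trans cd d5.
rewrite disjoints_subset subUset !sub1set !inE -!val_eqE /= !inordK //.
by rewrite !negb_or -!andbA.
Qed.

Lemma pair_set_surj (A : {set 'I_5}) : #|A| == 2 -> exists i : 'I_10, A = pair_set i.
Proof.
move=> /cards2P[x [y [xy ->]]].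
wlog ltxy : x y xy / x < y.
  move=> H; have := xy; rewrite -val_eqE neq_ltn => /orP[lt|lt]; first exact: H.
  by rewrite setUC; apply: H => //; rewrite eq_sym.
pose i := index (val x, val y) pair_list.
have xyin : (val x, val y) \in pair_list.
  by move: x y ltxy {i xy} => [[|[|[|[|[|x]]]]] //= ?] [[|[|[|[|[|y]]]]] //= ?].
have i10 : i < 10 by rewrite (_ : 10 = size pair_list) // index_mem.
exists (Ordinal i10); rewrite /pair_set /= nth_index // !inord_val //.
Qed.

Lemma petersen_embeds : embeds petersen petersen10.
Proof.
(* The default [ord0] is never returned, since every 2-subset is listed. *)
pose f (A : petersen) : petersen10 :=
  odflt ord0 [pick i : 'I_10 | val A == pair_set i].
have fK (A : petersen) : pair_set (f A) = val A.
  rewrite /f; case: pickP => [i /eqP //|no].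
  by have [i E] := pair_set_surj (valP A); have := no i; rewrite E eqxx.
have fI : injective f by move=> A B E; apply: val_inj; rewrite -!fK E.
exists f => // A B.
by rewrite /= /simp (inj_eq fI) -!fK !pair_set_disjoint.
Qed.

Lemma petersen10_embeds : embeds petersen10 petersen.
Proof.
pose f (i : petersen10) : petersen := Sub (pair_set i) (card_pair_set i).
have fA i j : [disjoint val (f i) & val (f j)] = pairs_disjoint i j.
  exact: pair_set_disjoint.
have fI : injective f.
  move=> i j E.
  (* Injectivity follows because distinct indices have distinct neighbourhoods, which is checked by
     enumeration. *)
  have Eij (k : 'I_10) : pairs_disjoint i k = pairs_disjoint j k by rewrite -!fA E.
  apply: val_inj; apply/eqP.
  have H : all (fun i => all (fun j => (i == j) ||
    has (fun k => pairs_disjoint i k != pairs_disjoint j k) (iota 0 10)) (iota 0 10)) (iota 0 10).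
    by vm_compute.
  have mem10 (k : 'I_10) : val k \in iota 0 10 by rewrite mem_iota /= ltn_ord.
  case/orP: (allP (allP H _ (mem10 i)) _ (mem10 j)) => // /hasP[k].
  by rewrite mem_iota => k10; rewrite (Eij (Ordinal k10)) eqxx.
exists f => // i j.
by rewrite /= /simp (inj_eq fI) !fA.
Qed.

(* Read off the 3-uniform word of Kitaev and Pyatkin for the Petersen graph. *)
Definition petersen_positions : seq (nat * nat * nat) :=
  [:: (0,14,24); (7,18,23); (5,10,25); (1,11,17); (9,13,26);
      (2,16,21); (3,8,19); (4,15,29); (6,20,28); (12,22,27)].

Lemma model3_petersen : model3 petersen.
Proof.
apply: model3_embeds petersen_embeds _.
pose p i := (nth (0,0,0) petersen_positions i).1.1.
pose q i := (nth (0,0,0) petersen_positions i).1.2.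
pose r i := (nth (0,0,0) petersen_positions i).2.
have H : all (fun i => (p i < q i < r i) && all (fun j => (i == j) ||
    disjoint3 (p i) (q i) (r i) (p j) (q j) (r j) &&
    ((pairs_disjoint i j || pairs_disjoint j i)
       == alt3 (p i) (q i) (r i) (p j) (q j) (r j))) (iota 0 10)) (iota 0 10).
  by vm_compute.
have mem10 (i : 'I_10) : val i \in iota 0 10 by rewrite mem_iota /= ltn_ord.
have H1 (i : 'I_10) := andP (allP H _ (mem10 i)).
have H2 (i j : 'I_10) : i != j -> disjoint3 (p i) (q i) (r i) (p j) (q j) (r j) &&
    ((pairs_disjoint i j || pairs_disjoint j i)
       == alt3 (p i) (q i) (r i) (p j) (q j) (r j)).
  have [_ /allP Hi] := H1 i.
  by rewrite -val_eqE; case/orP: (Hi _ (mem10 j)) => [->|].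
exists (fun i => p (val i)), (fun i => q (val i)), (fun i => r (val i)); split.
- by move=> i; have [] := H1 i.
- by move=> i j /H2/andP[].
- by move=> i j ij; have /andP[_ /eqP <-] := H2 _ _ ij; rewrite /= /simp ij.
Qed.

(** Vertex 0 is the pair 01, with neighbours 23, 24 and 34. Any two of these are joined by a
    three-edge path, the rest of a 5-cycle through 01, that avoids the closed neighbourhood of the
    third. *)
Lemma not_model2_petersen : ~ model2 petersen.
Proof.
move/(model2_embeds petersen10_embeds) => M.
have [o oE] : exists o : nat -> petersen10, forall k, o k = @inord 9 k by exists (@inord 9).
have adjE i j : i < 10 -> j < 10 ->
    adj (o i) (o j) = (i != j) && (pairs_disjoint i j || pairs_disjoint j i).
  by move=> i10 j10; rewrite !oE /= /simp -val_eqE /= !inordK.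
have eqE i j : i < 10 -> j < 10 -> (o i == o j) = (i == j).
  by move=> i10 j10; rewrite !oE -val_eqE /= !inordK.
move: petersen10 o {oE} M adjE eqE => G o M adjE eqE.
have := @chord_separates _ (o 0) (o 7) (o 8) (o 9) M.
rewrite /= !inE !adjE // !eqE //= => /(_ isT isT isT isT isT isT isT)[] H.
- by have := separates_path (s := [:: o 6; o 1; o 9]) H;
    rewrite /= !adjE // !eqE //= => /(_ isT erefl).
- by have := separates_path (s := [:: o 5; o 3; o 7]) H;
    rewrite /= !adjE // !eqE //= => /(_ isT erefl).
- by have := separates_path (s := [:: o 4; o 2; o 8]) H;
    rewrite /= !adjE // !eqE //= => /(_ isT erefl).
Qed.


(** * Adjacency in prisms, and the lower bound from four rungs on *)

Lemma succ_modn i n : i < n -> i.+1 %% n = if i.+1 == n then 0 else i.+1.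
Proof.
by move=> lt_i; case: eqP => [->|ne]; rewrite ?modnn // modn_small //; lia.
Qed.

Lemma adj_prism n (s t : bool) (i j : 'I_n) : 2 < n ->
  @adj (prism n) (s, i) (t, j) =
  if s == t then [|| val j == i.+1, val i == j.+1,
                     (val i == 0) && (j.+1 == n) | (val j == 0) && (i.+1 == n)]
  else val i == val j.
Proof.
move=> n2; have li := ltn_ord i; have lj := ltn_ord j.
rewrite /= /simp /prism_rel /= xpair_eqE (eq_sym t s) -val_eqE.
rewrite /= !succ_modn //; move: (nat_of_ord i) (nat_of_ord j) li lj => {}i {}j li lj.
by case: eqP => /= _; [case: ifP; case: ifP|]; lia.
Qed.

(** The common neighbour is the outer vertex 0, with neighbours 0', 1 and the last outer vertex. Two
    of the linking paths pass through inner vertices; the third runs along the outer cycle away from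
    0. *)
Lemma not_model2_prism n : 3 < n -> ~ model2 (prism n).
Proof.
(* From here on [n] is the last index, and the prism has [n.+1] rungs. *)
case: n => [|[|[|[|m]]]] // _ M; set n := m.+3 in M *.
have [o oE] : exists o : bool -> nat -> prism n.+1, forall s k, o s k = (s, inord k)
  by exists (fun s k => (s, inord k)).
have adjE s t i j : i <= n -> j <= n -> adj (o s i) (o t j) =
    if s == t then [|| j == i.+1, i == j.+1, (i == 0) && (j == n) | (j == 0) && (i == n)]
    else i == j.
  by move=> li lj; rewrite !oE adj_prism /= ?inordK //; lia.
have eqE s t i j : i <= n -> j <= n -> (o s i == o t j) = (s == t) && (i == j).
  by move=> li lj; rewrite !oE xpair_eqE -val_eqE /= !inordK.
move: (prism n.+1) o {oE} M adjE eqE => G o M adjE eqE.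
have n1 : 1 <= n by [].
have nn : n <= n by [].
have := @chord_separates _ (o false 0) (o true 0) (o false 1) (o false n) M.
rewrite /= !inE !adjE // !eqE //= ?eqxx ?orbT.
move=> /(_ isT isT isT isT isT isT isT)[] H.
- have := separates_path (s := [:: o true n; o false n]) H.
  rewrite /= !adjE // !eqE //= ?eqxx ?orbT.
  by move=> /(_ isT erefl).
- have := separates_path (s := [:: o true 1; o true 0]) H.
  rewrite /= !adjE // !eqE //= ?eqxx ?orbT.
  by move=> /(_ isT erefl).
(* The outer path from 1 to [n] has variable length, so the colouring is followed along it by
   induction. *)
- case: H => S /eqP Sne SP; case: Sne.
  suff H k : k < n -> S (o false k.+1) = S (o false 1).
    exact: (H m.+2).
  elim: k => // k IH lt_k; rewrite -IH; last exact: ltnW.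
  by apply: SP; rewrite ?adjE ?eqE //= ?eqxx ?orbT //; lia.
Qed.

(** * The lower bound for the triangular prism *)

Lemma noncrossing_left a b x y : ~~ cross2 a b x y -> a < x -> x < b -> y <= b.
Proof.
by move=> N ax xb; rewrite leqNgt; apply: contraNN N => h; rewrite /cross2 ax xb h.
Qed.

Lemma noncrossing_right a b x y : ~~ cross2 a b x y -> x < a -> a < y -> b <= y.
Proof.
by move=> N xa ay; rewrite leqNgt; apply: contraNN N => h; rewrite /cross2 xa ay h orbT.
Qed.

(** On a circle, a chord crossing only the first of three pairwise crossing chords cuts off a single
    end of it, [a] or [A]. The gap between [C] and [a] contains the origin of the line, so cutting
    off [a] splits into two cases. *)
Lemma crosses_first_only a b c A B C d D :
  a < b -> b < c -> c < A -> A < B -> B < C -> d < D ->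
  [&& b != d, b != D, B != d, B != D, c != d, c != D, C != d & C != D] ->
  cross2 a A d D -> ~~ cross2 b B d D -> ~~ cross2 c C d D ->
  [|| [&& d < a, a < D & D < b], [&& c < d, d < A, A < D & D < B]
    | [&& a < d, d < b & C < D]].
Proof.
move=> ab bc cA AB BC dD dis /orP[] /and3P[h1 h2 h3] Nb Nc.
  have [db|bd] := ltnP d b.
    have CD : C <= D by apply: (noncrossing_right Nc); lia.
    by apply/or3P/Or33; lia.
  have DB : D <= B by apply: (noncrossing_left Nb); lia.
  have [dc|cd] := ltnP d c; last by apply/or3P/Or32; lia.
  have CD : C <= D by apply: (noncrossing_right Nc); lia.
  lia.
have [Db|bD] := ltnP D b; first by apply/or3P/Or31; lia.
have BD : B <= D by apply: (noncrossing_right Nb); lia.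
lia.
Qed.

Lemma crosses_second_only a b c A B C e E :
  a < b -> b < c -> c < A -> A < B -> B < C -> e < E ->
  [&& a != e, a != E, A != e, A != E, c != e, c != E, C != e & C != E] ->
  ~~ cross2 a A e E -> cross2 b B e E -> ~~ cross2 c C e E ->
  [&& a < e, e < b, b < E & E < c] || [&& A < e, e < B, B < E & E < C].
Proof.
move=> ab bc cA AB BC eE dis Na /orP[] /and3P[h1 h2 h3] Nc.
  have [eA|Ae] := ltnP e A.
    have EA : E <= A by apply: (noncrossing_left Na); lia.
    lia.
  have EC : E <= C by apply: (noncrossing_left Nc); lia.
  by apply/orP; right; lia.
have [Ec|cE] := ltnP E c; last first.
  have CE : C <= E by apply: (noncrossing_right Nc); lia.
  lia.
have [ea|ae] := ltnP e a; last by apply/orP; left; lia.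
have AE : A <= E by apply: (noncrossing_right Na); lia.
lia.
Qed.

Lemma crosses_third_only a b c A B C f F :
  a < b -> b < c -> c < A -> A < B -> B < C -> f < F ->
  [&& a != f, a != F, A != f, A != F, b != f, b != F, B != f & B != F] ->
  ~~ cross2 a A f F -> ~~ cross2 b B f F -> cross2 c C f F ->
  [|| [&& b < f, f < c, c < F & F < A], [&& B < f, f < C & C < F]
    | [&& f < a, B < F & F < C]].
Proof.
move=> ab bc cA AB BC fF dis Na Nb /orP[] /and3P[h1 h2 h3].
  have [fB|Bf] := ltnP f B; last by apply/or3P/Or32; lia.
  have FB : F <= B by apply: (noncrossing_left Nb); lia.
  lia.
have [fb|bf] := ltnP f b.
  have BF : B <= F by apply: (noncrossing_right Nb); lia.
  have [fa|af] := ltnP f a; first by apply/or3P/Or33; lia.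
  have FA : F <= A by apply: (noncrossing_left Na); lia.
  lia.
have FA : F <= A by apply: (noncrossing_left Na); lia.
by apply/or3P/Or31; lia.
Qed.

(** Each chord of the second triangle cuts off one end of its partner. Two of them cross only if
    these ends are consecutive in the cyclic order [a b c A B C], and a 6-cycle contains no
    triangle. *)
Lemma sorted_triangles_false a b c A B C d D e E f F :
  a < b -> b < c -> c < A -> A < B -> B < C -> d < D -> e < E -> f < F ->
  [&& b != d, b != D, B != d, B != D, c != d, c != D, C != d & C != D] ->
  [&& a != e, a != E, A != e, A != E, c != e, c != E, C != e & C != E] ->
  [&& a != f, a != F, A != f, A != F, b != f, b != F, B != f & B != F] ->
  cross2 a A d D -> ~~ cross2 b B d D -> ~~ cross2 c C d D ->
  ~~ cross2 a A e E -> cross2 b B e E -> ~~ cross2 c C e E ->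
  ~~ cross2 a A f F -> ~~ cross2 b B f F -> cross2 c C f F ->
  cross2 d D e E -> cross2 e E f F -> cross2 d D f F -> False.
Proof.
move=> ab bc cA AB BC dD eE fF Hd He Hf ad bd cd ae be ce af bf cf de ef df.
have d3 := crosses_first_only ab bc cA AB BC dD Hd ad bd cd.
have e2 := crosses_second_only ab bc cA AB BC eE He ae be ce.
have f3 := crosses_third_only ab bc cA AB BC fF Hf af bf cf.
clear -ab bc cA AB BC de ef df d3 e2 f3; move: de ef df; rewrite /cross2.
by case/or3P: d3 => d3; case/orP: e2 => e2; case/or3P: f3 => f3; lia.
Qed.


(** Pairwise crossing chords have their right ends in the order of their left ends, after all the
    left ends. *)
Lemma sorted_prism3_false (G : sgraph) (p q : G -> nat) (u v : 'I_3 -> G) (i j k : 'I_3) :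
  uniq [:: i; j; k] ->
  (forall z, p z < q z) ->
  (forall y z, y != z -> [&& p y != p z, p y != q z, q y != p z & q y != q z]) ->
  (forall m l, u m != v l) ->
  (forall m l, m != l -> cross2 (p (u m)) (q (u m)) (p (u l)) (q (u l))) ->
  (forall m l, m != l -> cross2 (p (v m)) (q (v m)) (p (v l)) (q (v l))) ->
  (forall m l, cross2 (p (u m)) (q (u m)) (p (v l)) (q (v l)) = (m == l)) ->
  p (u i) < p (u j) -> p (u j) < p (u k) -> False.
Proof.
move=> /=; rewrite !inE !negb_or => /and3P[/andP[ij ik] jk _].
move=> pq dd uv uu vv uvE ltij ltjk.
have ji : j != i by rewrite eq_sym.
have ki : k != i by rewrite eq_sym.
have kj : k != j by rewrite eq_sym.
have N m l : m != l -> ~~ cross2 (p (u m)) (q (u m)) (p (v l)) (q (v l)) by rewrite uvE.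
have Y m : cross2 (p (u m)) (q (u m)) (p (v m)) (q (v m)) by rewrite uvE eqxx.
have dis m l r : [&& p (u m) != p (v r), p (u m) != q (v r), q (u m) != p (v r),
    q (u m) != q (v r), p (u l) != p (v r), p (u l) != q (v r), q (u l) != p (v r)
    & q (u l) != q (v r)].
  by have /and4P[-> -> -> ->] := dd _ _ (uv m r); exact: dd (uv l r).
have cij : [/\ p (u j) < q (u i) & q (u i) < q (u j)].
  by move: (uu _ _ ij) ltij; rewrite /cross2; clear; lia.
have cjk : p (u k) < q (u j) /\ q (u j) < q (u k).
  by move: (uu _ _ jk) ltjk; rewrite /cross2; clear; lia.
have cik : p (u k) < q (u i).
  by move: (uu _ _ ik) ltij ltjk; rewrite /cross2; clear; lia.
case: cij cjk => _ cij [_ cjk].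
by apply: (sorted_triangles_false ltij ltjk cik cij cjk (pq (v i)) (pq (v j)) (pq (v k))
  (dis j k i) (dis i k j) (dis i j k)); auto.
Qed.

Lemma not_model2_prism3 : ~ model2 (prism 3).
Proof.
move=> [p [q [P1 P2 P3]]].
pose u (i : 'I_3) : prism 3 := (false, i); pose v (i : 'I_3) : prism 3 := (true, i).
have uv m l : u m != v l by [].
have nu (w : bool) (m l : 'I_3) : m != l ->
    cross2 (p (w, m)) (q (w, m)) (p (w, l)) (q (w, l)).
  move=> ml; rewrite -P3; last by rewrite xpair_eqE eqxx.
  rewrite adj_prism // eqxx.
  by move: m l ml => [[|[|[|m]]] //= ?] [[|[|[|l]]] //= ?].
have uvE m l : cross2 (p (u m)) (q (u m)) (p (v l)) (q (v l)) = (m == l).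
  by rewrite -P3 // adj_prism.
have C i j k : i != j -> i != k -> j != k -> p (u i) < p (u j) -> p (u j) < p (u k) -> False.
  move=> ij ik jk.
  apply: (@sorted_prism3_false _ p q u v) P1 P2 uv (nu false) (nu true) uvE.
  by rewrite /= !inE negb_or ij ik jk.
have ne m l : m != l -> p (u m) != p (u l).
  by move=> ml; have /P2/and4P[] : u m != u l by rewrite xpair_eqE eqxx.
pose o0 : 'I_3 := inord 0; pose o1 : 'I_3 := inord 1; pose o2 : 'I_3 := inord 2.
have [n01 n02 n12] : [/\ o0 != o1, o0 != o2 & o1 != o2].
  by split; rewrite -val_eqE /= !inordK.
have [n10 n20 n21] : [/\ o1 != o0, o2 != o0 & o2 != o1] by rewrite !(eq_sym o2) (eq_sym o1).
move: (ne _ _ n01) (ne _ _ n02) (ne _ _ n12); rewrite !neq_ltn.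
case/orP=> l01; case/orP=> l02; case/orP=> l12.
- by apply: (C o0 o1 o2).
- by apply: (C o0 o2 o1).
- by have := ltn_trans l01 (ltn_trans l12 l02); rewrite ltnn.
- by apply: (C o2 o0 o1).
- by apply: (C o1 o0 o2).
- by have := ltn_trans l02 (ltn_trans l12 l01); rewrite ltnn.
- by apply: (C o1 o2 o0).
- by apply: (C o2 o1 o0).
Qed.

(** * Three-position models of the prisms *)

(* Found by computer search; the vertex [(b, i)] has index [b * n + i]. *)
Definition prism_table n : seq (nat * nat * nat) :=
  if n == 3 then [:: (3,8,16); (0,7,14); (4,12,17); (1,6,11); (5,10,15); (2,9,13)]
  else [:: (1,12,16); (8,15,20); (10,18,23); (3,14,22);
           (0,5,13); (4,9,17); (6,11,21); (2,7,19)].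

(** The periodic arrangement used for larger prisms fails here: with four rungs, for instance, it
    makes opposite inner vertices alternate. *)
Lemma model3_small_prism n : (n == 3) || (n == 4) -> model3 (prism n).
Proof.
move=> n34; pose t (b : bool) i := nth (0,0,0) (prism_table n) (b * n + i).
pose p b i := (t b i).1.1; pose q b i := (t b i).1.2; pose r b i := (t b i).2.
pose adjn (s t : bool) i j := if s == t then [|| j == i.+1, i == j.+1,
    (i == 0) && (j.+1 == n) | (j == 0) && (i.+1 == n)] else i == j.
have H : all (fun b => all (fun i => (p b i < q b i < r b i) &&
    all (fun c => all (fun j => ((b == c) && (i == j)) ||
    disjoint3 (p b i) (q b i) (r b i) (p c j) (q c j) (r c j) &&
    (adjn b c i j == alt3 (p b i) (q b i) (r b i) (p c j) (q c j) (r c j)))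
    (iota 0 n)) [:: false; true]) (iota 0 n)) [:: false; true].
  by rewrite {}/adjn {}/p {}/q {}/r {}/t; case/orP: n34 => /eqP ->; vm_compute.
have memb b : b \in [:: false; true] by case: b.
have memn (i : 'I_n) : val i \in iota 0 n by rewrite mem_iota /= ltn_ord.
have H1 b (i : 'I_n) := andP (allP (allP H _ (memb b)) _ (memn i)).
have H2 (x y : prism n) : x != y ->
    disjoint3 (p x.1 x.2) (q x.1 x.2) (r x.1 x.2) (p y.1 y.2) (q y.1 y.2) (r y.1 y.2) &&
    (adj x y == alt3 (p x.1 x.2) (q x.1 x.2) (r x.1 x.2) (p y.1 y.2) (q y.1 y.2) (r y.1 y.2)).
  case: x y => [b i] [c j]; have [_ /allP /(_ _ (memb c)) /allP Hi] := H1 b i.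
  rewrite adj_prism; last by case/orP: n34 => /eqP ->.
  by rewrite xpair_eqE -val_eqE; case/orP: (Hi _ (memn j)) => [->|].
exists (fun x : prism n => p x.1 x.2), (fun x : prism n => q x.1 x.2),
  (fun x : prism n => r x.1 x.2); split.
- by move=> [b i]; have [] := H1 b i.
- by move=> x y /H2/andP[].
- by move=> x y /H2/andP[_ /eqP].
Qed.


(* The positions [6 i], [6 i + 7], [6 i + 14] (resp. [6 i + 4], [6 i + 11],
   [6 i + 21]) modulo [6 n], in increasing order. *)
Definition cyclic_positions (b : bool) (n i : nat) : nat * nat * nat :=
  let: (x, y, z) := if b then (6 * i + 4, 6 * i + 11, 6 * i + 21)
                    else (6 * i, 6 * i + 7, 6 * i + 14) in
  if z < 6 * n then (x, y, z)
  else if y < 6 * n then (z - 6 * n, x, y)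
  else (y - 6 * n, z - 6 * n, x).

Lemma cyclic_positions_increasing b n i : 4 < n -> i < n ->
  let: (x, y, z) := cyclic_positions b n i in x < y < z.
Proof. by rewrite /cyclic_positions; case: b => n4 lti; do !case: ifP => ?; lia. Qed.

(** The offsets 0, 7, 14, 4, 11, 21 represent all residues modulo 6, and reduction modulo [6 * n]
    preserves them; so a position determines its offset and then its index. *)
Lemma cyclic_positions_disjoint b c n i j : 4 < n -> i < n -> j < n ->
  ~~ ((b == c) && (i == j)) ->
  let: (x, y, z) := cyclic_positions b n i in
  let: (x', y', z') := cyclic_positions c n j in disjoint3 x y z x' y' z'.
Proof.
rewrite /cyclic_positions /disjoint3.
case: b c => -[] n4 lti ltj /= ne; do !case: ifP => ?;
  by do 8?[apply/andP; split]; lia.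
Qed.

(** A shift by 6 interleaves each triple with its translate, while larger cyclic shifts leave two
    neighbouring positions of one triple unseparated. Rotating a 3-uniform word preserves
    alternation, so wrapping around is harmless. *)
Lemma cyclic_positions_alt b n i j : 4 < n -> i < j -> j < n ->
  let: (x, y, z) := cyclic_positions b n i in
  let: (x', y', z') := cyclic_positions b n j in
  alt3 x y z x' y' z' = (j == i.+1) || (i == 0) && (j.+1 == n).
Proof.
rewrite /cyclic_positions.
case: b => n4 lti ltj /=; do !case: ifP => ?; rewrite /alt3; lia.
Qed.

Lemma cyclic_positions_rung n i j : 4 < n -> i < n -> j < n ->
  let: (x, y, z) := cyclic_positions false n i in
  let: (x', y', z') := cyclic_positions true n j in
  alt3 x y z x' y' z' = (i == j).
Proof.
rewrite /cyclic_positions.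
move=> n4 lti ltj /=; do !case: ifP => ?; rewrite /alt3; lia.
Qed.

Lemma model3_large_prism n : 4 < n -> model3 (prism n).
Proof.
move=> n4; have n2 : 2 < n by apply: ltn_trans n4.
pose P (x : prism n) := cyclic_positions x.1 n x.2.
have altE (x y : prism n) : x != y ->
    adj x y = alt3 (P x).1.1 (P x).1.2 (P x).2 (P y).1.1 (P y).1.2 (P y).2.
  case: x y => [b i] [c j]; rewrite xpair_eqE -val_eqE adj_prism //= /P /= => ne.
  have [li lj] := (ltn_ord i, ltn_ord j).
  case: eqP ne => [<-|] /=.
    rewrite neq_ltn => /orP[lt|lt].
      have := cyclic_positions_alt b n4 lt lj.
      case: (cyclic_positions b n i) => -[x y] z;
        case: (cyclic_positions b n j) => -[x' y'] z' /= ->.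
      by clear -lt lj; lia.
    have := cyclic_positions_alt b n4 lt li.
    case: (cyclic_positions b n i) => -[x y] z; case: (cyclic_positions b n j) => -[x' y'] z' /=.
    by rewrite alt3_sym => ->; clear -lt li; lia.
  case: b c => -[] // _ _.
    have := cyclic_positions_rung n4 lj li.
    case: (cyclic_positions _ n i) => -[x y] z; case: (cyclic_positions _ n j) => -[x' y'] z' /=.
    by rewrite alt3_sym eq_sym => ->.
  have := cyclic_positions_rung n4 li lj.
  by case: (cyclic_positions _ n i) => -[x y] z;
     case: (cyclic_positions _ n j) => -[x' y'] z' /= ->.
exists (fun x => (P x).1.1), (fun x => (P x).1.2), (fun x => (P x).2); split=> //.
  move=> [b i]; have := cyclic_positions_increasing b n4 (ltn_ord i).
  by rewrite /P /=; case: (cyclic_positions _ n i) => -[x y] z.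
move=> [b i] [c j]; rewrite xpair_eqE -val_eqE => ne.
have := cyclic_positions_disjoint n4 (ltn_ord i) (ltn_ord j) ne; rewrite /P /=.
by case: (cyclic_positions _ n i) => -[x y] z; case: (cyclic_positions _ n j) => -[x' y'] z'.
Qed.

(** * Uniformity below two, and the conclusion *)

(** Listing all vertices twice in the same order makes every two chords cross. *)
Lemma complete_model2 (G : sgraph) :
  (forall x y : G, x != y -> adj x y) -> model2 G.
Proof.
move=> cG; exists (fun v => val (enum_rank v)), (fun v => #|G| + val (enum_rank v)).
have lt (v : G) : val (enum_rank v) < #|G| := ltn_ord _.
have ne (u v : G) : u != v -> val (enum_rank u) != val (enum_rank v).
  by rewrite val_eqE (inj_eq enum_rank_inj).
split=> [v|u v /ne|u v uv]; first exact: ltn_addr (lt v).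
  by have := lt u; have := lt v; clear; lia.
by rewrite cG //; move: (ne _ _ uv) (lt u) (lt v); rewrite /cross2; clear; lia.
Qed.

(** Every vertex must occur in the word, so the graph has no vertex. *)
Lemma uniform0_model2 (G : sgraph) : k_word_representable G 0 -> model2 G.
Proof.
move=> [w [U [inw _]]]; apply: complete_model2 => x y _.
by have := inw x; rewrite -has_pred1 has_count U.
Qed.

(** Two letters occurring once each always alternate, so the graph is complete. *)
Lemma uniform1_model2 (G : sgraph) : k_word_representable G 1 -> model2 G.
Proof.
move=> [w [U [inw A]]]; apply: complete_model2 => x y xy.
apply/(A _ _ xy); rewrite /alternate; set F := filter _ _.
have uF : uniq F by apply/filter_uniq/count_mem_uniq => z; rewrite U inw.
have : perm_eq F [:: x; y].
  apply: uniq_perm => //; first by rewrite /= inE xy.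
  by move=> z; rewrite mem_filter inw andbT !inE.
case: F uF => [|a [|b [|c s]]] /=; try by move=> _ /perm_size.
rewrite inE andbT => ab /perm_mem E; exists 2.
move: (E a) (E b); rewrite !inE !eqxx ?orbT /=.
case/esym/orP => /eqP Ea; case/esym/orP => /eqP Eb; rewrite Ea Eb ?eqxx // in ab *.
  by left.
by right.
Qed.

Lemma generated_models (G : sgraph) : generated G -> model3 G /\ ~ model2 G.
Proof.
elim=> {G} [|n n3|G v l _ [m3 m2] l0|G x y l _ [m3 m2] xy l3].
- by split; [exact: model3_petersen | exact: not_model2_petersen].
- have [n34|n4] : n < 5 \/ 4 < n by lia.
    split; first by apply: model3_small_prism; lia.
    have [->|n4] : n = 3 \/ 3 < n by lia.
      exact: not_model2_prism3.
    exact: not_model2_prism.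
  by split; [exact: model3_large_prism | apply: not_model2_prism; exact: ltnW].
- by split; [exact: model3_op1 | move/(model2_embeds (op1_embeds v l))].
- split; first by apply: model3_op2 => //; lia.
  by move/(model2_embeds (op2_embeds x y _)).
Qed.

Theorem theorem13 (G : sgraph) : generated G -> in_R 3 G.
Proof.
move=> /generated_models[/model3_word R3 N2].
split; first by case: R3 => w [_ Rw]; exists w.
split=> // -[|[|[|j]]] // _ R; apply: N2.
- exact: uniform0_model2.
- exact: uniform1_model2.
- exact: word_model2.
Qed.
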